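(* Let $\mathcal T=[\mathbf A,\mathbf B,\mathbf C]_R$ with $\mathbf A\in\mathbb F^{I\times R}$, $\mathbf B\in\mathbb F^{J\times R}$, $\mathbf C\in\mathbb F^{K\times R}$, and let $$m_{\mathbf A}:=R-r_{\mathbf A}+2,\quad m_{\mathbf B}:=R-r_{\mathbf B}+2,\quad m_{\mathbf C}:=R-r_{\mathbf C}+2.$$ Assume that at least two of the following three conditions hold: (i) $H_{\mathbf B\mathbf C}(\delta)\ge\min(\delta,m_{\mathbf A})$ for all $\delta=1,\dots,R$; (ii) $H_{\mathbf C\mathbf A}(\delta)\ge\min(\delta,m_{\mathbf B})$ for all $\delta=1,\dots,R$; (iii) $H_{\mathbf A\mathbf B}(\delta)\ge\min(\delta,m_{\mathbf C})$ for all $\delta=1,\dots,R$. Then $r_{\mathcal T}=R$ and the CPD of $\mathcal T$ is unique.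
   Context: $\mathbb F$ is $\mathbb R$ or $\mathbb C$. For matrices $\mathbf A,\mathbf B,\mathbf C$ with $R$ nonzero columns each, $[\mathbf A,\mathbf B,\mathbf C]_R:=\sum_{r=1}^R\mathbf a_r\circ\mathbf b_r\circ\mathbf c_r$ ($\circ$ = outer product). The rank $r_{\mathcal T}$ of a tensor is the minimal number of terms in such a representation; a representation with $R=r_{\mathcal T}$ terms is a canonical polyadic decomposition (CPD). The CPD of a tensor $\mathcal T$ of rank $R$ is unique if $\mathcal T=[\mathbf A,\mathbf B,\mathbf C]_R=[\bar{\mathbf A},\bar{\mathbf B},\bar{\mathbf C}]_R$ implies that there are an $R\times R$ permutation matrix $\mathbf\Pi$ and nonsingular diagonal matrices $\mathbf\Lambda_{\mathbf A},\mathbf\Lambda_{\mathbf B},\mathbf\Lambda_{\mathbf C}$ with $\bar{\mathbf A}=\mathbf A\mathbf\Pi\mathbf\Lambda_{\mathbf A}$, $\bar{\mathbf B}=\mathbf B\mathbf\Pi\mathbf\Lambda_{\mathbf B}$, $\bar{\mathbf C}=\mathbf C\mathbf\Pi\mathbf\Lambda_{\mathbf C}$, $\mathbf\Lambda_{\mathbf A}\mathbf\Lambda_{\mathbf B}\mathbf\Lambda_{\mathbf C}=\mathbf I_R$. $r_{\mathbf M}$ is the rank of a matrix $\mathbf M$. For matrices $\mathbf X,\mathbf Y$ with $R$ columns and $1\le\delta\le R$, $H_{\mathbf X\mathbf Y}(\delta):=\min_{S}\,[\,r_{\mathbf X_S}+r_{\mathbf Y_S}-\delta\,]$, where $S$ ranges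 over subsets of $\{1,\dots,R\}$ of cardinality $\delta$ and $\mathbf X_S,\mathbf Y_S$ are the submatrices formed by the columns indexed by $S$. *)

(* Defs.v *)
From mathcomp Require Import all_boot all_order all_fingroup all_algebra.
From mathcomp Require Import boolp reals complex.

Set Implicit Arguments.
Unset Strict Implicit.
Unset Printing Implicit Defensive.

Import Order.TTheory GRing.Theory Num.Theory.
Local Open Scope ring_scope.

Notation tensor F I J K := {ffun 'I_I * 'I_J * 'I_K -> F}.

Definition outer (F : fieldType) (I J K : nat)
    (a : 'cV[F]_I) (b : 'cV[F]_J) (c : 'cV[F]_K) : tensor F I J K :=
  [ffun t => a t.1.1 0 * b t.1.2 0 * c t.2 0].

Definition polyadic (F : fieldType) (I J K R : nat)
    (A : 'M[F]_(I, R)) (B : 'M[F]_(J, R)) (C : 'M[F]_(K, R)) : tensor F I J K :=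
  \sum_(r < R) outer (col r A) (col r B) (col r C).

Definition nonzero_cols (F : fieldType) (m n : nat) (X : 'M[F]_(m, n)) : Prop :=
  forall r : 'I_n, col r X != 0.

Definition is_polyadic (F : fieldType) (I J K R : nat) (T : tensor F I J K)
    (A : 'M[F]_(I, R)) (B : 'M[F]_(J, R)) (C : 'M[F]_(K, R)) : Prop :=
  [/\ nonzero_cols A, nonzero_cols B, nonzero_cols C & T = polyadic A B C].

Definition has_polyadic (F : fieldType) (I J K : nat) (T : tensor F I J K)
    (R : nat) : Prop :=
  exists (A : 'M[F]_(I, R)) (B : 'M[F]_(J, R)) (C : 'M[F]_(K, R)),
    is_polyadic T A B C.

Lemma ex_polyadic (F : fieldType) (I J K : nat) (T : tensor F I J K) :
  exists R, `[< has_polyadic T R >].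
Proof.
pose S := [set t | T t != 0].
have TS (r : 'I_#|S|) : T (enum_val r) != 0.
  by have := enum_valP r; rewrite inE.
exists #|S|; apply/asboolP.
exists (\matrix_(i, r) (T (enum_val r) *+ (i == (enum_val r).1.1))).
exists (\matrix_(j, r) (j == (enum_val r).1.2)%:R).
exists (\matrix_(k, r) (k == (enum_val r).2)%:R).
split=> [r|r|r|].
- apply/eqP => /matrixP /(_ (enum_val r).1.1 0).
  by rewrite !mxE eqxx mulr1n; apply/eqP.
- apply/eqP => /matrixP /(_ (enum_val r).1.2 0).
  by rewrite !mxE eqxx; apply/eqP/oner_neq0.
- apply/eqP => /matrixP /(_ (enum_val r).2 0).
  by rewrite !mxE eqxx; apply/eqP/oner_neq0.
apply/ffunP => t; rewrite /polyadic sum_ffunE.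
under eq_bigr => r _.
  rewrite !ffunE !mxE -[_ *+ _]mulr_natr -!mulrA -!natrM !mulnb andbA.
  have -> : (t.1.1 == (enum_val r).1.1) && (t.1.2 == (enum_val r).1.2)
            && (t.2 == (enum_val r).2) = (t == enum_val r).
    by case: t (enum_val r) => [[i j] k] [[i' j'] k'].
  over.
rewrite -(big_enum_val (A := mem S) (fun u => T u * (t == u)%:R)) /=.
have [tS|tS] := boolP (t \in S).
  rewrite (bigD1 t) //= eqxx mulr1 big1 ?addr0 // => u /andP[_ /negPf].
  by rewrite eq_sym => ->; rewrite mulr0.
rewrite big1 => [|u uS]; first by move: tS; rewrite inE negbK => /eqP.
by case: eqP => [tu|]; rewrite ?mulr0 //; move: tS; rewrite tu uS.
Qed.

Definition tensor_rank (F : fieldType) (I J K : nat) (T : tensor F I J K) : nat :=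
  ex_minn (ex_polyadic T).

Definition cpd_unique (F : fieldType) (I J K : nat) (T : tensor F I J K) : Prop :=
  forall (R : nat)
    (A A' : 'M[F]_(I, R)) (B B' : 'M[F]_(J, R)) (C C' : 'M[F]_(K, R)),
    tensor_rank T = R ->
    is_polyadic T A B C -> is_polyadic T A' B' C' ->
    exists P LA LB LC : 'M[F]_R,
      [/\ is_perm_mx P,
          [/\ is_diag_mx LA, is_diag_mx LB & is_diag_mx LC],
          [/\ LA \in unitmx, LB \in unitmx & LC \in unitmx],
          [/\ A' = A *m P *m LA, B' = B *m P *m LB & C' = C *m P *m LC] &
          LA *m LB *m LC = 1%:M].

Definition cols (F : fieldType) (m n : nat) (X : 'M[F]_(m, n)) (S : {set 'I_n}) :
    'M[F]_(m, #|S|) :=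
  colsub (fun i : 'I_#|S| => enum_val i) X.

(* H_XY(delta) = min_S [rank X_S + rank Y_S - delta], S of cardinality delta.
   The value is integral because rank X_S + rank Y_S - delta can be negative.
   The default value delta of the iterated minimum is harmless: each rank is at
   most #|S| = delta, so every term is at most delta, and for delta <= R the
   minimum is attained (lemmas rank_excess_le and rank_excess_attained). *)
Definition rank_excess (F : fieldType) (m n R : nat)
    (X : 'M[F]_(m, R)) (Y : 'M[F]_(n, R)) (delta : nat) : int :=
  \big[Order.min/delta%:Z]_(S : {set 'I_R} | #|S| == delta)
     ((\rank (cols X S))%:Z + (\rank (cols Y S))%:Z - delta%:Z).

Lemma rank_excess_le (F : fieldType) (m n R : nat)
    (X : 'M[F]_(m, R)) (Y : 'M[F]_(n, R)) (S : {set 'I_R}) :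
  rank_excess X Y #|S| <=
    (\rank (cols X S))%:Z + (\rank (cols Y S))%:Z - #|S|%:Z.
Proof. exact: bigmin_le_cond. Qed.

Lemma rank_excess_attained (F : fieldType) (m n R : nat)
    (X : 'M[F]_(m, R)) (Y : 'M[F]_(n, R)) (delta : nat) :
  (delta <= R)%N ->
  exists2 S : {set 'I_R}, #|S| = delta &
    rank_excess X Y delta =
      (\rank (cols X S))%:Z + (\rank (cols Y S))%:Z - delta%:Z.
Proof.
move=> dR.
have S0P : #|[set widen_ord dR i | i : 'I_delta]| == delta.
  by rewrite card_imset ?card_ord // => i j /(congr1 val) /= /val_inj.
rewrite /rank_excess.
rewrite (bigmin_eq_arg _ [set widen_ord dR i | i : 'I_delta]) //.
  by case: arg_minP => // S /eqP cS _; exists S.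
move=> S /eqP cS; rewrite lerBlDr -!PoszD lez_nat.
by apply: leq_add; apply: leq_trans (rank_leq_col _) _; rewrite cS.
Qed.

Definition excess_condition (F : fieldType) (m n R : nat)
    (X : 'M[F]_(m, R)) (Y : 'M[F]_(n, R)) (M : nat) : Prop :=
  forall delta : nat, (1 <= delta <= R)%N ->
    (minn delta M)%:Z <= rank_excess X Y delta.

(* Main.v *)
Require Import Defs.
From mathcomp Require Import all_boot all_order all_fingroup all_algebra.
From mathcomp Require Import boolp reals complex.
From mathcomp Require Import zify ring.

Set Implicit Arguments.
Unset Strict Implicit.
Unset Printing Implicit Defensive.

Import Order.TTheory GRing.Theory Num.Theory.
Local Open Scope ring_scope.

(** Either of the conditions, say (i), gives
    [2 |S| + 2 <= rank A_S + rank B_S + rank C_S] for every [S] with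
    [|S| >= 2]: if the minimum is [m_A], use [rank A_S >= rank A - (R - |S|)];
    if it is [|S|], then [B_S] and [C_S] have full column rank, and
    [rank A_S >= 2] follows from the other condition.  Under this inequality
    the statement is the Lovitz-Petrov generalization of Kruskal's theorem.

    Call a family [E] of vectors split if it has a partition into two nonempty
    parts whose spans meet only in [0].  If a family of pure tensors
    [x_a (x) y_a (x) z_a] does not split, its span has dimension at least
    [dim x + dim y + dim z - 2].  Put together the terms of [[A, B, C]_R] and
    the opposites of those of another decomposition with at most [R] terms.
    They sum to zero, so their span is too small for them not to split; each
    part again sums to zero, and induction matches the terms in pairs. *)

(** * Spans and ranks of finite families of vectors *)

Section Families.

Variables (F : fieldType) (Q : finType).
Implicit Types (S E : {set Q}).

Definition rowfam n (f : Q -> 'rV[F]_n) S : 'M[F]_(#|S|, n) :=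
  \matrix_(i < #|S|) f (enum_val i).

Definition rk n (f : Q -> 'rV[F]_n) S := \rank (rowfam f S).

Lemma rowfam_subP m n (f : Q -> 'rV[F]_n) S (B : 'M_(m, n)) :
  reflect {in S, forall a, (f a <= B)%MS} (rowfam f S <= B)%MS.
Proof.
apply: (iffP row_subP) => fB a; last by rewrite rowK fB ?enum_valP.
by move=> aS; have := fB (enum_rank_in aS a); rewrite rowK enum_rankK_in.
Qed.

Lemma sub_rowfam n (f : Q -> 'rV[F]_n) S a :
  a \in S -> (f a <= rowfam f S)%MS.
Proof. by apply/rowfam_subP. Qed.

Lemma rowfam_sumP n (f : Q -> 'rV[F]_n) S (v : 'rV_n) :
  reflect (exists c : Q -> F, v = \sum_(a in S) c a *: f a)
          (v <= rowfam f S)%MS.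
Proof.
apply: (iffP idP) => [|[c ->]]; last first.
  by apply: summx_sub => a aS; rewrite scalemx_sub ?sub_rowfam.
have [->|/set0Pn[a0 a0S]] := eqVneq S set0.
  have -> : rowfam f set0 = 0.
    by apply/eqP; rewrite -mxrank_eq0 -leqn0 -(cards0 Q) rank_leq_row.
  by move=> /submx0null ->; exists (fun=> 0); rewrite big_set0.
case/submxP=> D ->; exists (fun a => D 0 (enum_rank_in a0S a)).
rewrite mulmx_sum_row [RHS]big_enum_val /=.
by apply: eq_bigr => i _; rewrite rowK enum_valK_in.
Qed.

Lemma rowfamS n (f : Q -> 'rV[F]_n) S E :
  S \subset E -> (rowfam f S <= rowfam f E)%MS.
Proof. by move/subsetP=> SE; apply/rowfam_subP=> a /SE; apply: sub_rowfam. Qed.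

Lemma rkS n (f : Q -> 'rV[F]_n) S E : S \subset E -> (rk f S <= rk f E)%N.
Proof. by move=> SE; apply/mxrankS/rowfamS. Qed.

Lemma rowfamU n (f : Q -> 'rV[F]_n) S E :
  (rowfam f (S :|: E) :=: rowfam f S + rowfam f E)%MS.
Proof.
apply/eqmxP/andP; split; last by rewrite addsmx_sub !rowfamS ?subsetUl ?subsetUr.
apply/rowfam_subP=> a /setUP[] aS.
  exact: submx_trans (sub_rowfam _ aS) (addsmxSl _ _).
exact: submx_trans (sub_rowfam _ aS) (addsmxSr _ _).
Qed.

Lemma rk_card n (f : Q -> 'rV[F]_n) S : (rk f S <= #|S|)%N.
Proof. exact: rank_leq_row. Qed.

Lemma rowfam_dependent n (f : Q -> 'rV[F]_n) S a :
  a \in S -> (f a <= rowfam f (S :\ a))%MS ->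
  (rowfam f S <= rowfam f (S :\ a))%MS.
Proof.
move=> aS fa; apply/rowfam_subP=> b bS.
by have [->//|ba] := eqVneq b a; rewrite sub_rowfam // !inE ba.
Qed.

(** Induction on [#|S|]: if adding [a] did not raise the rank, [f a] would lie in the span of the
    others. *)
Lemma rk_free n (f : Q -> 'rV[F]_n) S :
  {in S, forall a, ~~ (f a <= rowfam f (S :\ a))%MS} -> rk f S = #|S|.
Proof.
move: {2}#|S| (erefl #|S|) => k; elim: k S => [|k IH] S cS freeS.
  by apply/eqP; rewrite cS -leqn0 -cS rk_card.
have /set0Pn[a aS] : S != set0 by rewrite -card_gt0 cS.
have cSa : #|S :\ a| = k by move: (cardsD1 a S); rewrite aS cS; case.
have rSa : rk f (S :\ a) = k.
  rewrite -[RHS]cSa; apply: IH => // b /setD1P[ba bS].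
  apply: contra (freeS b bS) => /submx_trans; apply; apply: rowfamS.
  by apply: setSD; rewrite subsetDl.
apply/eqP; rewrite cS eqn_leq -{1}cS rk_card /= ltnNge.
apply: contra (freeS a aS) => rS.
apply: submx_trans (sub_rowfam _ aS) _.
rewrite -(geq_leqif (mxrank_leqif_sup (rowfamS f (subsetDl S [set a])))).
by rewrite (leq_trans rS) // -rSa.
Qed.

(** * Splitting families and product families *)

Definition splits n (f : Q -> 'rV[F]_n) E :=
  [exists S : {set Q}, [&& S != set0, S \proper E &
    (rowfam f S :&: rowfam f (E :\: S))%MS == 0]].

(** The pure tensor of [u a] and [z a], flattened to a row vector so that a third factor can be
    added by iteration. *)
Definition prodfam m n (u : Q -> 'rV[F]_m) (z : Q -> 'rV[F]_n) a :
  'rV[F]_(m * n) := mxvec ((u a)^T *m z a).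

(** A combination of the matrices [(u a)^T *m z a] has its columns in the span of [u] and its rows
    in the span of [z]. *)
Lemma prodfam_sub m n (u : Q -> 'rV[F]_m) (z : Q -> 'rV[F]_n) S v :
  (v <= rowfam (prodfam u z) S)%MS ->
  ((vec_mx v)^T <= rowfam u S)%MS /\ (vec_mx v <= rowfam z S)%MS.
Proof.
move=> /rowfam_sumP[c ->]; rewrite !linear_sum /=.
split; apply: summx_sub => a aS; rewrite !linearZ /= mxvecK.
  by rewrite trmx_mul trmxK scalemx_sub // mulmx_sub ?sub_rowfam.
by rewrite scalemx_sub // mulmx_sub ?sub_rowfam.
Qed.

(** The same [S] works: a tensor in both product spans has its columns in two spans of [u] that meet
    only in 0. *)
Lemma splits_prodfam m n (u : Q -> 'rV[F]_m) (z : Q -> 'rV[F]_n) E :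
  splits u E -> splits (prodfam u z) E.
Proof.
case/existsP=> S /and3P[S0 SE uS]; apply/existsP; exists S; rewrite S0 SE /=.
move: uS => /eqP uS; rewrite -submx0; apply/rV_subP=> v.
rewrite sub_capmx => /andP[/prodfam_sub[v1 _] /prodfam_sub[v2 _]].
have : ((vec_mx v)^T <= (rowfam u S :&: rowfam u (E :\: S))%MS)%MS.
  by rewrite sub_capmx v1.
rewrite uS submx0 => /eqP v0.
by rewrite submx0 -[v]vec_mxK -[vec_mx v]trmxK v0 trmx0 linear0.
Qed.

(** [cokermx V] is the quotient map by the span of [V], so rank-nullity on [W] counts what [W] adds
    to [V]. *)
Lemma rk_cokermx m n k (V : 'M[F]_(k, n)) (W : 'M[F]_(m, n)) :
  \rank (V + W)%MS = (\rank V + \rank (W *m cokermx V))%N.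
Proof.
have kerE : (V :&: W :=: W :&: kermx (cokermx V))%MS.
  rewrite capmxC; apply: cap_eqmx => //; apply/eqmxP/andP; split.
    by apply/sub_kermxP; rewrite mulmx_coker.
  by rewrite submxE mulmx_ker.
have := mxrank_mul_ker W (cokermx V); have := mxrank_sum_cap V W.
rewrite kerE; lia.
Qed.

(* With [X] a minimal subset of [E] whose span meets that of [S], the product
   rank grows by [#|X| - 1] when [X] is added to [S].  The relation
   [sum_X c_a u_a (x) z_a = w], with [w] in the span of [S] and all [c_a] nonzero,
   vanishes modulo the span of [u] over [S], so Sylvester's inequality bounds
   the growth of [rk u] by [#|X| - rk z X]; and [w != 0] makes [rk z] grow by
   less than [rk z X]. *)
Lemma rk_prodfam_extend m n (u : Q -> 'rV[F]_m) (z : Q -> 'rV[F]_n) S E :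
    (rowfam (prodfam u z) S :&: rowfam (prodfam u z) E)%MS != 0 ->
    (rk u S + rk z S <= rk (prodfam u z) S + 1)%N ->
  exists2 S' : {set Q}, [/\ S' \subset E & S' != set0] &
    (rk u (S :|: S') + rk z (S :|: S') <= rk (prodfam u z) (S :|: S') + 1)%N.
Proof.
set p := prodfam u z => SE0 rS.
pose meets := [pred X : {set Q} | (rowfam p S :&: rowfam p X)%MS != 0].
have [X /minsetP[SX0 minX] XE] := @minset_exists _ meets E SE0.
rewrite /= in SX0 minX.
have drop a : a \in X -> (rowfam p S :&: rowfam p (X :\ a))%MS = 0.
  move=> aX; apply/eqP/negPn/negP=> /minX /(_ (subsetDl _ _)) /setP /(_ a).
  by rewrite !inE eqxx aX.
have subdrop a (v : 'rV_(m * n)) : a \in X -> (v <= rowfam p S)%MS ->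
    (v <= rowfam p (X :\ a))%MS -> v = 0.
  by move=> aX vS vX; apply/eqP; rewrite -submx0 -(drop a aX) sub_capmx vS.
have freeX : {in X, forall a, ~~ (p a <= rowfam p (X :\ a))%MS}.
  move=> a aX; apply/negP=> /(rowfam_dependent aX) sX.
  by case/negP: SX0; rewrite -submx0 -(drop a aX) capmxS.
have [w wSX w0] : exists2 w : 'rV_(m * n),
    (w <= rowfam p S :&: rowfam p X)%MS & w != 0.
  by case/rowV0Pn: SX0 => w; exists w.
move: wSX; rewrite sub_capmx => /andP[wS wX].
have [c wE] := rowfam_sumP _ _ _ wX.
have c0 a : a \in X -> c a != 0.
  move=> aX; apply: contraNneq w0 => ca0; apply/eqP/(subdrop a) => //.
  rewrite wE (big_setD1 a aX) /= ca0 scale0r add0r.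
  by apply: summx_sub => b bX; rewrite scalemx_sub ?sub_rowfam.
have [wu wz] := prodfam_sub wS.
have [_ wz'] := prodfam_sub wX.
pose W := vec_mx w.
have W0 : W != 0 by apply: contraNneq w0 => W0; rewrite -[w]vec_mxK -/W W0 linear0.
have X0 : X != set0.
  by apply: contraNneq w0 => X0; rewrite wE X0 big_set0.
have /set0Pn[a aX] := X0.
exists X; first by split.
(* Without [a], the products over [X] are independent and, by minimality of [X], their span meets
   that of [S] only in 0. *)
have rp : (rk p S + #|X| <= rk p (S :|: X) + 1)%N.
  have : (rk p S + rk p (X :\ a) <= rk p (S :|: X))%N.
    rewrite /rk -(mxrank_disjoint_sum (drop a aX)) -rowfamU.
    by apply: rkS; rewrite setUS ?subsetDl.
  rewrite (@rk_free _ p (X :\ a)) ?(cardsD1 a X) ?aX; first lia.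
  move=> b /setD1P[ba bX]; apply: contra (freeX b bX) => /submx_trans; apply.
  by apply: rowfamS; rewrite setSD ?subsetDl.
have ru : (rk u (S :|: X) + rk z X <= rk u S + #|X|)%N.
  rewrite /rk rowfamU rk_cokermx -addnA leq_add2l.
  pose zc := fun b => c b *: z b.
  have -> : \rank (rowfam z X) = \rank (rowfam zc X).
    apply/eqmx_rank/andP; split; apply/rowfam_subP=> b bX.
      rewrite -[z b](scalerK (c0 b bX)) scalemx_sub //.
      exact: (sub_rowfam zc).
    by rewrite scalemx_sub ?sub_rowfam.
  rewrite -(mxrank_tr (_ *m _)); apply: mulmx0_rank_max.
  rewrite trmx_mul -mulmxA; suff -> : (rowfam u X)^T *m rowfam zc X = W.
    by apply: trmx_inj; rewrite trmx_mul trmxK trmx0; apply/eqP; rewrite -submxE.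
  rewrite /W wE linear_sum /= big_enum_val /=.
  apply/matrixP=> i j; rewrite mxE summxE; apply: eq_bigr => k _.
  by rewrite linearZ /= mxvecK !mxE big_ord1 !mxE mulrCA.
have rz : (rk z (S :|: X) < rk z S + rk z X)%N.
  rewrite /rk rowfamU -mxrank_sum_cap -addn1 leq_add2l lt0n mxrank_eq0.
  by apply: contraNneq W0 => SX; rewrite -submx0 -SX sub_capmx wz.
lia.
Qed.

(** Take a maximal [S] satisfying the inequality, starting from a singleton. If [S] is not [E], its
    span meets that of [E :\: S], as the products do not split, and [rk_prodfam_extend] enlarges
    [S]. *)
Lemma rk_prodfam m n (u : Q -> 'rV[F]_m) (z : Q -> 'rV[F]_n) E :
    E != set0 -> {in E, forall a, prodfam u z a != 0} ->
    ~~ splits (prodfam u z) E ->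
  (rk u E + rk z E <= rk (prodfam u z) E + 1)%N.
Proof.
set p := prodfam u z => /set0Pn[a aE] p0 nsE.
pose good := [pred S : {set Q} |
  (S \subset E) && (rk u S + rk z S <= rk p S + 1)%N].
have ga : good [set a].
  rewrite /= sub1set aE /=.
  have p1 : (0 < rk p [set a])%N.
    rewrite lt0n mxrank_eq0; apply: contraNneq (p0 a aE) => fa0.
    by have := sub_rowfam p (set11 a); rewrite fa0 => /submx0null->.
  have := rk_card u [set a]; have := rk_card z [set a]; rewrite cards1; lia.
have [S /maxsetP[/andP[SE rS] maxS] aS] := maxset_exists ga.
have [<-//|SnE] := eqVneq S E.
have SE0 : (rowfam p S :&: rowfam p (E :\: S))%MS != 0.
  apply: contra nsE => nS; apply/existsP; exists S.
  by rewrite properEneq SnE SE nS -card_gt0 (leq_trans _ (subset_leq_card aS)) ?cards1.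
have [X [XE X0] rX] := rk_prodfam_extend SE0 rS.
case/negP: X0; rewrite -subset0 -(setDv S).
have SX : S :|: X = S.
  apply: maxS (subsetUl _ _); rewrite /= rX andbT subUset SE /=.
  exact: subset_trans XE (subsetDl _ _).
have XS : X \subset S by rewrite -SX subsetUr.
apply/subsetP=> b bX; have := subsetP XE _ bX.
by rewrite !inE (subsetP XS _ bX).
Qed.

(** * Families with zero sum *)

Lemma rk_zero_sum n (p : Q -> 'rV[F]_n) E :
  E != set0 -> \sum_(a in E) p a = 0 -> (rk p E < #|E|)%N.
Proof.
case/set0Pn=> a aE; rewrite (big_setD1 a aE) /= => /addr0_eq pa.
rewrite (cardsD1 a E) aE /= add1n ltnS; apply: leq_trans (rk_card p _).
apply/mxrankS/rowfam_dependent => //; rewrite -eqmx_opp pa.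
by apply: summx_sub => b bE; apply: sub_rowfam.
Qed.

(** The two partial sums are opposite, so each lies in both spans. *)
Lemma splits_zero_sum n (p : Q -> 'rV[F]_n) E :
    splits p E -> \sum_(a in E) p a = 0 ->
  exists2 S : {set Q}, S != set0 /\ S \proper E &
    \sum_(a in S) p a = 0 /\ \sum_(a in E :\: S) p a = 0.
Proof.
case/existsP=> S /and3P[S0 SE /eqP capS] sE; exists S => //.
have SE' := proper_sub SE.
have pS : \sum_(a in S) p a + \sum_(a in E :\: S) p a = 0.
  by move: sE; rewrite (big_setID S) /= (setIidPr SE').
suff s0 : \sum_(a in S) p a = 0 by split=> //; move: pS; rewrite s0 add0r.
suff : ((\sum_(a in S) p a)%R <= rowfam p S :&: rowfam p (E :\: S))%MS.
  by rewrite capS => /submx0null.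
rewrite sub_capmx; apply/andP; split.
  by apply: summx_sub => b bE; apply: sub_rowfam.
move/addr0_eq: pS => pS; rewrite -eqmx_opp pS.
by apply: summx_sub => b bE; apply: sub_rowfam.
Qed.

(** [X] marks the terms of one decomposition. Having equality of cardinalities as a conclusion also
    excludes a second decomposition with fewer terms. *)
Lemma zero_sum_match l m n (x : Q -> 'rV[F]_l) (y : Q -> 'rV[F]_m)
    (z : Q -> 'rV[F]_n) (X E : {set Q}) :
  let p := prodfam (prodfam x y) z in
    (forall a, p a != 0) ->
    (forall S : {set Q}, S \subset X -> (2 <= #|S|)%N ->
      (2 * #|S| + 2 <= rk x S + rk y S + rk z S)%N) ->
    (#|E :\: X| <= #|E :&: X|)%N -> \sum_(a in E) p a = 0 ->
  #|E :\: X| = #|E :&: X| /\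
  {in E :&: X, forall a, exists2 b, b \in E :\: X & p a + p b = 0}.
Proof.
move=> p p0 rkX; move: {2}#|E|.+1 (ltnSn #|E|) => k.
elim: k E => // k IH E; rewrite ltnS => Ek cE sE.
have [/eqP EX0|EX_gt0] := posnP #|E :&: X|.
  rewrite (eqP EX0); move: cE; rewrite (eqP EX0) leqn0 => /eqP ->; split=> // a.
  by move: EX0; rewrite cards_eq0 => /eqP ->; rewrite inE.
(* A single term in [X] faces at most one outside, and exactly one since [p a] is nonzero. *)
have [EX2|EX2] := ltnP 1 #|E :&: X|; last first.
  have EX1 : #|E :&: X| = 1%N by apply/eqP; rewrite eqn_leq EX2.
  have /eqP/cards1P[a Ea] := EX1.
  move: sE; rewrite (big_setID X) /= Ea big_set1.
  move: cE; rewrite EX1 leq_eqVlt ltnS leqn0 => /orP[/cards1P[b Eb]|].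
    rewrite Eb big_set1 !cards1 => pab; split=> // _ /set1P->.
    by exists b; rewrite ?set11.
  rewrite cards_eq0 => /eqP ->; rewrite big_set0 addr0 => pa0.
  by have := p0 a; rewrite pa0 eqxx.
have E0 : E != set0.
  by apply: contraTneq EX_gt0 => ->; rewrite set0I cards0.
(* Without a split, two uses of [rk_prodfam] bound the sum of the three ranks by [rk p E + 2], hence
   by [#|E| + 1] and by [2 * #|E :&: X| + 1], against [rkX]. *)
have spE : splits p E.
  apply: contraT => nsE.
  have nsxy : ~~ splits (prodfam x y) E by apply: contra nsE; apply: splits_prodfam.
  have q0 : {in E, forall a, prodfam x y a != 0}.
    move=> a _; apply: contraNneq (p0 a) => xy0.
    by rewrite /p /prodfam -/(prodfam x y a) xy0 trmx0 mul0mx linear0.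
  have := rk_prodfam E0 q0 nsxy.
  have := rk_prodfam E0 (fun a _ => p0 a) nsE; rewrite -/p.
  have := rk_zero_sum E0 sE; have := rkX _ (subsetIr E X) EX2.
  have := rkS x (subsetIl E X); have := rkS y (subsetIl E X).
  have := rkS z (subsetIl E X); move: cE.
  rewrite -[#|E|](cardsID X); lia.
have [S [S0 SE] [sS sES]] := splits_zero_sum spE sE.
have SE' := proper_sub SE.
have ltS : (#|S| < k)%N by apply: leq_trans Ek; apply: proper_card.
have ltES : (#|E :\: S| < k)%N.
  apply: leq_trans Ek; rewrite -(cardsID S E) (setIidPr SE').
  by rewrite -[X in (X < _)%N]add0n ltn_add2r card_gt0.
have cI : #|E :&: X| = (#|S :&: X| + #|(E :\: S) :&: X|)%N.
  rewrite -(cardsID S) -setIA [X :&: S]setIC setIA (setIidPr SE'); congr addn.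
  by apply: eq_card => b; rewrite !inE; case: (b \in S); rewrite ?andbF.
have cD : #|E :\: X| = (#|S :\: X| + #|(E :\: S) :\: X|)%N.
  rewrite -(cardsID S); congr addn; apply: eq_card => b; rewrite !inE.
    by have [/(subsetP SE') ->|] := boolP (b \in S); rewrite ?andbT ?andbF.
  by rewrite andbCA.
(* If [S] had more elements outside [X] than inside, [E :\: S] would have fewer,
   against the induction hypothesis. *)
have [le1|lt1] := leqP #|S :\: X| #|S :&: X|; last first.
  have [] := IH (E :\: S) ltES _ sES; lia.
have [c1 m1] := IH S ltS le1 sS.
have [|c2 m2] := IH (E :\: S) ltES _ sES; first lia.
split; first lia.
move=> a /setIP[aE aX]; have [aS|aS] := boolP (a \in S).
  have [|b /setDP[bS bX] pb] := m1 a; first by rewrite inE aS.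
  by exists b; rewrite // inE bX (subsetP SE').
have [|b /setDP[/setDP[bE _] bX] pb] := m2 a; first by rewrite !inE aS aE.
by exists b; rewrite // inE bX bE.
Qed.

End Families.

(** * Tensor decompositions as product families *)

Lemma prodfamE (F : fieldType) (Q : finType) m n (u : Q -> 'rV[F]_m)
    (z : Q -> 'rV[F]_n) a i j :
  prodfam u z a 0 (mxvec_index i j) = u a 0 i * z a 0 j.
Proof. by rewrite /prodfam mxvecE mxE big_ord1 mxE. Qed.

Lemma prodfam_neq0 (F : fieldType) (Q : finType) m n (u : Q -> 'rV[F]_m)
    (z : Q -> 'rV[F]_n) a :
  u a != 0 -> z a != 0 -> prodfam u z a != 0.
Proof.
case/rV0Pn=> i ui /rV0Pn[j zj]; apply/rV0Pn; exists (mxvec_index i j).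
by rewrite prodfamE mulf_neq0.
Qed.

Lemma rk_cols (F : fieldType) m n (M : 'M[F]_(m, n)) (S : {set 'I_n}) :
  rk (fun i => (col i M)^T) S = \rank (cols M S).
Proof.
by rewrite -[RHS]mxrank_tr; congr (\rank _); apply/matrixP=> i j; rewrite !mxE.
Qed.

Section Decompositions.

Variables (F : fieldType) (I J K : nat).
Implicit Types (T : tensor F I J K).

(** Fix an entry where [a], [b] and [c] do not vanish. Varying one index at a time gives
    proportionality, with ratios read off at that entry, where the equality makes their product
    1. *)
Lemma outer_scaling (a a' : 'cV[F]_I) (b b' : 'cV[F]_J) (c c' : 'cV[F]_K) :
    a != 0 -> b != 0 -> c != 0 -> outer a b c = outer a' b' c' ->
  exists t : F * F * F, [/\ t.1.1 * t.1.2 * t.2 = 1,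
    a' = t.1.1 *: a, b' = t.1.2 *: b & c' = t.2 *: c].
Proof.
move=> /cV0Pn[i0 ai] /cV0Pn[j0 bj] /cV0Pn[k0 ck] /ffunP eqo.
have e i j k : a i 0 * b j 0 * c k 0 = a' i 0 * b' j 0 * c' k 0.
  by have := eqo (i, j, k); rewrite !ffunE.
have e0 := e i0 j0 k0.
have : a' i0 0 * b' j0 0 * c' k0 0 != 0 by rewrite -e0 !mulf_neq0.
rewrite !mulf_eq0 !negb_or -andbA => /and3P[ai' bj' ck'].
have ratio (d d' s0 s0' s s' : F) : d' != 0 -> s0 != 0 ->
    s * d = s' * d' -> s0 * d = s0' * d' -> s' = s0' / s0 * s.
  move=> d'0 s00 sd s0d; apply: (mulIf d'0); rewrite -sd mulrAC -mulrA mulrAC.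
  by rewrite mulrA -s0d -[RHS]mulrA mulrAC mulrC; field.
exists (a' i0 0 / a i0 0, b' j0 0 / b j0 0, c' k0 0 / c k0 0); split=> /=.
- by rewrite !mulf_div -e0 divff // !mulf_neq0.
- apply/colP=> i; rewrite mxE.
  apply: (ratio (b j0 0 * c k0 0) (b' j0 0 * c' k0 0)); rewrite ?mulf_neq0 //.
    by have := e i j0 k0; rewrite -!mulrA.
  by rewrite !mulrA.
- apply/colP=> j; rewrite mxE.
  apply: (ratio (a i0 0 * c k0 0) (a' i0 0 * c' k0 0)); rewrite ?mulf_neq0 //.
    by have := e i0 j k0; rewrite -!mulrA ![_ * (_ j 0 * _)]mulrCA.
  by move: e0; rewrite -!mulrA ![_ * (_ j0 0 * _)]mulrCA.
- apply/colP=> k; rewrite mxE.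
  apply: (ratio (a i0 0 * b j0 0) (a' i0 0 * b' j0 0)); rewrite ?mulf_neq0 //.
    by have := e i0 j0 k; rewrite ![_ * _ k 0]mulrC.
  by move: e0; rewrite ![_ * _ k0 0]mulrC.
Qed.

(** The columns of [A], [B], [C] form the left summand of the index type, which is the set [X] of
    [zero_sum_match]. *)
Lemma is_polyadic_match T R r (A : 'M[F]_(I, R)) (B : 'M[F]_(J, R))
    (C : 'M[F]_(K, R)) (A' : 'M[F]_(I, r)) (B' : 'M[F]_(J, r))
    (C' : 'M[F]_(K, r)) :
    (forall S : {set 'I_R}, (2 <= #|S|)%N -> (2 * #|S| + 2 <=
       \rank (cols A S) + \rank (cols B S) + \rank (cols C S))%N) ->
    is_polyadic T A B C -> is_polyadic T A' B' C' -> (r <= R)%N ->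
  r = R /\ forall i : 'I_R, exists j : 'I_r,
    outer (col i A) (col i B) (col i C) = outer (col j A') (col j B') (col j C').
Proof.
move=> rkS [A0 B0 C0 TE] [A'0 B'0 C'0 TE'] rR.
pose fam n (M : 'M[F]_(n, R)) (M' : 'M[F]_(n, r)) (a : 'I_R + 'I_r) :=
  match a with inl i => (col i M)^T | inr j => (col j M')^T end.
(* The sign of the opposite terms is carried by the first factor. *)
pose x := fam _ A (- A'); pose y := fam _ B B'; pose z := fam _ C C'.
pose p := prodfam (prodfam x y) z.
have pl i k : p (inl i) 0 (mxvec_index (mxvec_index k.1.1 k.1.2) k.2) =
    outer (col i A) (col i B) (col i C) k.
  by rewrite /p !prodfamE ffunE !mxE.
have pr j k : p (inr j) 0 (mxvec_index (mxvec_index k.1.1 k.1.2) k.2) =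
    - outer (col j A') (col j B') (col j C') k.
  by rewrite /p !prodfamE ffunE !mxE !mulNr.
have fam0 n (M : 'M[F]_(n, R)) (M' : 'M[F]_(n, r)) a :
    nonzero_cols M -> nonzero_cols M' -> fam n M M' a != 0.
  by case: a => i M0 M'0; rewrite trmx_eq0; [exact: M0 | exact: M'0].
have A'N0 : nonzero_cols (- A').
  by move=> j; rewrite raddfN oppr_eq0; apply: A'0.
have p0 a : p a != 0 by rewrite !prodfam_neq0 ?fam0.
pose X : {set 'I_R + 'I_r} := [set inl i | i : 'I_R].
have XC : ~: X = [set inr j | j : 'I_r].
  apply/setP=> -[i|j]; rewrite !inE.
    by rewrite mem_imset ?inE; [symmetry; apply/imsetP=> -[] | move=> ? ? []].
  by rewrite [RHS]mem_imset ?inE; [apply/imsetP=> -[] | move=> ? ? []].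
have rkX (S : {set 'I_R + 'I_r}) : S \subset X -> (2 <= #|S|)%N ->
    (2 * #|S| + 2 <= rk x S + rk y S + rk z S)%N.
  move=> SX; pose S' := [set i | inl i \in S].
  have SE : S = inl @: S'.
    apply/setP=> a; apply/idP/imsetP=> [aS|[i ]]; last by rewrite inE => iS ->.
    by have /imsetP[i _ aE] := subsetP SX a aS; exists i; rewrite // inE -aE.
  have cS : #|S| = #|S'| by rewrite SE card_imset // => i j [].
  have rkfam n (M : 'M[F]_(n, R)) (M' : 'M[F]_(n, r)) :
      (\rank (cols M S') <= rk (fam n M M') S)%N.
    rewrite -mxrank_tr; apply/mxrankS/row_subP=> i.
    have iS : inl (enum_val i) \in S by have := enum_valP i; rewrite inE.
    apply: submx_trans (sub_rowfam (fam n M M') iS).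
    by rewrite -tr_col /= (_ : col i _ = col (enum_val i) M) //;
      apply/colP=> k; rewrite !mxE.
  move=> S2; apply: leq_trans (leq_add
    (leq_add (rkfam _ A (- A')) (rkfam _ B B')) (rkfam _ C C')).
  by rewrite cS rkS -?cS.
have sp : \sum_(a in setT) p a = 0.
  under eq_bigl => a do rewrite in_setT.
  rewrite big_sumType /=; apply/rowP; case/mxvec_indexP=> ij k.
  case/mxvec_indexP: ij => i j; rewrite mxE !summxE [RHS]mxE.
  under eq_bigr => s _ do rewrite (pl s (i, j, k)).
  under [X in _ + X]eq_bigr => s _ do rewrite (pr s (i, j, k)).
  have /ffunP/(_ (i, j, k)) := etrans (esym TE) TE'.
  rewrite /polyadic !sum_ffunE => ->; rewrite sumrN subrr //.
have cX : #|X| = R by rewrite card_imset ?card_ord // => ? ? [].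
have cXC : #|~: X| = r by rewrite XC card_imset ?card_ord // => ? ? [].
have [|cE mE] := zero_sum_match p0 rkX _ sp; first by rewrite setTI setTD cX cXC.
move: cE mE; rewrite setTI setTD cX cXC => rE mE; split=> // i.
have [|a] := mE (inl i); first by rewrite imset_f.
rewrite XC => /imsetP[j _ ->] /rowP pij; exists j; apply/ffunP=> k.
have := pij (mxvec_index (mxvec_index k.1.1 k.1.2) k.2).
by rewrite mxE pl pr [RHS]mxE => /subr0_eq.
Qed.

(** * Rank bounds from the excess conditions, and permuted scalings *)

Lemma excess_rank_bound R (A : 'M[F]_(I, R)) (B : 'M[F]_(J, R))
    (C : 'M[F]_(K, R)) (S : {set 'I_R}) :
    excess_condition B C (R - \rank A + 2) ->
    (2 <= #|S|)%N -> (2 <= \rank (cols A S))%N ->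
  (2 * #|S| + 2 <=
     \rank (cols A S) + \rank (cols B S) + \rank (cols C S))%N.
Proof.
move=> HBC S2 A2.
have cS : (#|S| <= R)%N by rewrite -[X in (_ <= X)%N]card_ord max_card.
have /HBC : (1 <= #|S| <= R)%N by rewrite cS andbT; lia.
move/le_trans => /(_ _ (rank_excess_le B C S)).
(* Each of the [R - #|S|] columns outside [S] adds at most 1 to the rank. *)
have rA : (\rank A <= \rank (cols A S) + (R - #|S|))%N.
  pose f i := (col i A)^T.
  have : (\rank A <= rk f (S :|: ~: S))%N.
    rewrite -mxrank_tr; apply/mxrankS/row_subP=> i.
    have iS : i \in S :|: ~: S by rewrite setUCr inE.
    apply: submx_trans (sub_rowfam f iS).
    by rewrite /f tr_col.
  rewrite {1}/rk rowfamU => /leq_trans; apply.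
  apply: leq_trans (mxrank_adds_leqif _ _) _.
  rewrite -rk_cols leq_add2l; apply: leq_trans (rk_card f _) _.
  by rewrite cardsCs setCK card_ord.
rewrite /minn; case: ifP => _; lia.
Qed.

End Decompositions.

(** [perm_mx s] on the right moves column [i] to position [s i], so the scalar at position [j] is
    [t (s^-1%g j)]. *)
Lemma scaled_perm (F : fieldType) n R (M M' : 'M[F]_(n, R)) (s : 'S_R)
    (t : 'I_R -> F) :
    (forall i, col (s i) M' = t i *: col i M) ->
  M' = M *m perm_mx s *m diag_mx (\row_j t (s^-1%g j)).
Proof.
move=> M'E; have -> : M *m perm_mx s = col_perm s^-1 M by rewrite col_permE invgK.
apply/matrixP=> k j; rewrite mul_mx_diag !mxE.
have /colP/(_ k) := M'E (s^-1%g j); by rewrite !mxE permKV mulrC => ->.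
Qed.

Lemma diag_mx_unit (F : fieldType) R (d : 'rV[F]_R) :
  (forall j, d 0 j != 0) -> diag_mx d \in unitmx.
Proof. by move=> d0; rewrite unitmxE det_diag unitfE; apply/prodf_neq0. Qed.

(** The minimum in the condition is at least 2, so the two ranks add up to at least [#|S| + 2],
    while each is at most [#|S|]. *)
Lemma excess_rank2 (F : fieldType) m n R (X : 'M[F]_(m, R)) (Y : 'M[F]_(n, R))
    (M : nat) (S : {set 'I_R}) :
    excess_condition X Y (M + 2) -> (2 <= #|S|)%N ->
  (2 <= \rank (cols X S))%N /\ (2 <= \rank (cols Y S))%N.
Proof.
move=> HXY S2.
have cS : (#|S| <= R)%N by rewrite -[X in (_ <= X)%N]card_ord max_card.
have /HXY : (1 <= #|S| <= R)%N by rewrite cS andbT; lia.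
move/le_trans => /(_ _ (rank_excess_le X Y S)).
have := rank_leq_col (cols X S); have := rank_leq_col (cols Y S).
rewrite /minn; case: ifP => _ *; split; lia.
Qed.

(** Otherwise columns [i] and [j] of [A] would be proportional, hence of rank at most 1. This makes
    the matching of terms injective. *)
Lemma outer_inj (F : fieldType) I J K R (A : 'M[F]_(I, R)) (B : 'M[F]_(J, R))
    (C : 'M[F]_(K, R)) (i j : 'I_R) :
    nonzero_cols A -> nonzero_cols B -> nonzero_cols C ->
    (forall S : {set 'I_R}, (2 <= #|S|)%N -> (2 <= \rank (cols A S))%N) ->
    outer (col i A) (col i B) (col i C) = outer (col j A) (col j B) (col j C) ->
  i = j.
Proof.
move=> A0 B0 C0 A2 /outer_scaling -/(_ (A0 i) (B0 i) (C0 i))[t [_ tA _ _]].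
apply/eqP; apply: contraT => ij.
have /A2 : (2 <= #|[set i; j]|)%N by rewrite cards2 ij.
rewrite -rk_cols leqNgt ltnS; case/negP.
apply: (@leq_trans #|[set i]|); last by rewrite cards1.
apply: leq_trans (rk_card (fun k => (col k A)^T) _).
apply/mxrankS/rowfam_subP=> k /set2P[]->; first exact: (sub_rowfam _ (set11 i)).
by rewrite tA linearZ scalemx_sub //; apply: (sub_rowfam _ (set11 i)).
Qed.

Theorem corollary1p27 (RR : realType) (F : fieldType)
    (hF : F = RR :> fieldType \/ F = RR[i] :> fieldType)
    (I J K R : nat) (T : tensor F I J K)
    (A : 'M[F]_(I, R)) (B : 'M[F]_(J, R)) (C : 'M[F]_(K, R))
    (hT : is_polyadic T A B C)
    (mA mB mC : nat)
    (hmA : mA = (R - \rank A + 2)%N)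
    (hmB : mB = (R - \rank B + 2)%N)
    (hmC : mC = (R - \rank C + 2)%N)
    (hH : [\/ excess_condition B C mA /\ excess_condition C A mB,
              excess_condition B C mA /\ excess_condition A B mC |
              excess_condition C A mB /\ excess_condition A B mC]) :
  tensor_rank T = R /\ cpd_unique T.
Proof.
move: hH; rewrite hmA hmB hmC => hH.
(* Any two of the conditions together involve all three matrices. *)
have rank2 (S : {set 'I_R}) : (2 <= #|S|)%N -> [/\ (2 <= \rank (cols A S))%N,
    (2 <= \rank (cols B S))%N & (2 <= \rank (cols C S))%N].
  by move=> S2; case: hH => -[/excess_rank2/(_ S2)[? ?] /excess_rank2/(_ S2)[? ?]].
have rkS (S : {set 'I_R}) : (2 <= #|S|)%N -> (2 * #|S| + 2 <=
    \rank (cols A S) + \rank (cols B S) + \rank (cols C S))%N.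
  move=> S2; have [A2 B2 C2] := rank2 S S2; case: hH => -[H _].
  - exact: excess_rank_bound.
  - exact: excess_rank_bound.
  - by have := excess_rank_bound H S2 B2; lia.
have rkT : tensor_rank T = R.
  (* A shortest decomposition has at most [R] terms, so the matching gives it exactly [R]. *)
  rewrite /tensor_rank; case: ex_minnP => r /asboolP[A' [B' [C' hT']]] minr.
  have rR : (r <= R)%N by apply: minr; apply/asboolP; exists A, B, C.
  by have [] := is_polyadic_match rkS hT hT' rR.
split=> // R' A1 A2 B1 B2 C1 C2; rewrite rkT => RR'; subst R'.
move=> hT1 hT2.
(* The rank bound concerns [A], [B], [C], so two arbitrary decompositions are each matched with this
   one; [s] goes back along [s1], then on along [s2]. *)
have matching A' B' C' : is_polyadic T A' B' C' -> exists s : 'S_R, forall i,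
    outer (col i A) (col i B) (col i C) =
    outer (col (s i) A') (col (s i) B') (col (s i) C').
  move=> hT'; have [_ /choice[f fE]] := is_polyadic_match rkS hT hT' (leqnn R).
  have f_inj : injective f.
    case: hT => A0 B0 C0 _ i j fij.
    apply: (outer_inj A0 B0 C0) => [S /rank2[]//|].
    by rewrite !fE fij.
  by exists (perm f_inj) => i; rewrite permE.
have [s1 s1E] := matching _ _ _ hT1; have [s2 s2E] := matching _ _ _ hT2.
pose s := (s1^-1 * s2)%g.
have /choice[t tE] i : exists t : F * F * F, [/\ t.1.1 * t.1.2 * t.2 = 1,
    col (s i) A2 = t.1.1 *: col i A1, col (s i) B2 = t.1.2 *: col i B1 &
    col (s i) C2 = t.2 *: col i C1].
  case: hT1 => A0 B0 C0 _; apply: outer_scaling => //.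
  by rewrite /s permM -s2E s1E permKV.
have t0 i : [/\ (t i).1.1 != 0, (t i).1.2 != 0 & (t i).2 != 0].
  have [t1 _ _ _] := tE i; have := oner_neq0 F.
  by rewrite -t1 !mulf_eq0 !negb_or -andbA => /and3P[].
exists (perm_mx s), (diag_mx (\row_j (t (s^-1%g j)).1.1)),
  (diag_mx (\row_j (t (s^-1%g j)).1.2)), (diag_mx (\row_j (t (s^-1%g j)).2)).
split.
- exact: perm_mx_is_perm.
- by split; exact: diag_mx_is_diag.
- by split; apply: diag_mx_unit => j; rewrite mxE; have [] := t0 (s^-1%g j).
- by split; [apply: (scaled_perm (t := fun i => (t i).1.1))
    | apply: (scaled_perm (t := fun i => (t i).1.2))
    | apply: (scaled_perm (t := fun i => (t i).2))] => i; have [] := tE i.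
- rewrite !mulmx_diag -diag_const_mx; congr diag_mx; apply/rowP=> j.
  by rewrite !mxE; have [] := tE (s^-1%g j).
Qed.
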